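(* Let $A\in\mathbb{R}^{m\times n}$ and $b\in\mathbb{R}^m$ be such that $S_+=\{z\in\mathbb{R}^n_+ : Az=b\}$ is nonempty, and let $x_0\in\mathbb{R}^n_{++}$. Let $(x_k)$ be generated by entropic mirror descent with the Polyak-type stepsize $$\alpha_k=\min\left\{\frac{f(x_k)}{\|\nabla f(x_k)\|^2_{x_k}},\ \frac{1.79}{\|\nabla f(x_k)\|_\infty}\right\},\qquad x_{k+1}=x_k\circ\exp(-\alpha_k\nabla f(x_k)),$$ where $f(x)=\frac12\|Ax-b\|_2^2$ (if $\nabla f(x_k)=0$ for some $k$, the sequence is kept constant from then on). Then $(x_k)$ converges to some $x^*\in S_+$, and for all $k\ge0$ $$\min_{0\le i\le k} f(x_i)\le \frac{4R\,(R+\|x^*\|_1)\max_{j\le n}\|A_{:j}\|_2^2}{k+1},\qquad R=D_h(x^*,x_0).$$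
   Context: $\mathbb{R}^n_+$, $\mathbb{R}^n_{++}$ denote the nonnegative and strictly positive orthants; $\circ$ is componentwise multiplication and $\exp$, squares etc. act componentwise. $\nabla f(x)=A^\top(Ax-b)$. For $x\in\mathbb{R}^n_+$ and $v\in\mathbb{R}^n$, $\|v\|_x^2:=\sum_i x_iv_i^2$. $A_{:j}$ is the $j$-th column of $A$. The entropy is $h(x)=\sum_i x_i(\log x_i-1)$ on $\mathbb{R}^n_+$ (with $0\log0=0$) and $D_h(x,y)=\sum_i\big(x_i\log\frac{x_i}{y_i}-x_i+y_i\big)$ for $x\in\mathbb{R}^n_+$, $y\in\mathbb{R}^n_{++}$. *)

(* Defs.v *)
From mathcomp Require Import all_boot all_algebra all_classical all_reals all_analysis.
Import GRing.Theory Num.Theory numFieldNormedType.Exports.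
Set Implicit Arguments. Unset Strict Implicit. Unset Printing Implicit Defensive.
Local Open Scope ring_scope.

Section EMD.
Variables (R : realType) (m n : nat).
Implicit Types (A : 'M[R]_(m, n)) (b : 'cV[R]_m) (x y v : 'cV[R]_n).

Definition lsq_obj A b x : R := 2^-1 * \sum_(i < m) ((A *m x - b) i 0) ^+ 2.

Definition lsq_grad A b x : 'cV[R]_n := A^T *m (A *m x - b).

Definition wnorm2 x v : R := \sum_(i < n) x i 0 * (v i 0) ^+ 2.

Definition infnorm v : R := \big[Num.max/0]_(i < n) `|v i 0|.

Definition emd_step A b x : R :=
  Num.min (lsq_obj A b x / wnorm2 x (lsq_grad A b x))
          ((179%:R / 100%:R) / infnorm (lsq_grad A b x)).

Definition emd_update A b x : 'cV[R]_n :=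
  if lsq_grad A b x == 0 then x
  else \col_i (x i 0 * expR (- (emd_step A b x * lsq_grad A b x i 0))).

Fixpoint emd_seq A b (x0 : 'cV[R]_n) (k : nat) : 'cV[R]_n :=
  match k with
  | O => x0
  | S k' => emd_update A b (emd_seq A b x0 k')
  end.

Definition Splus A b (z : 'cV[R]_n) : Prop :=
  (forall i, 0 <= z i 0) /\ A *m z = b.

(* Bregman divergence of the entropy, with 0 log 0 = 0 *)
Definition breg_ent x y : R :=
  \sum_(i < n) ((if x i 0 == 0 then 0 else x i 0 * ln (x i 0 / y i 0))
                 - x i 0 + y i 0).

Definition norm1 x : R := \sum_(i < n) `|x i 0|.

Definition max_col_sqnorm A : R :=
  \big[Num.max/0]_(j < n) \sum_(i < m) (A i j) ^+ 2.

End EMD.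

(* Main.v *)
(* Let x be an iterate, g the gradient at x, a the stepsize and z a solution.
   On [-1.79, 1.79] one has exp t <= 1 + t + t^2, and <g, x - z> = 2 f(x), so a
   mirror step satisfies
     D(z, x+) <= D(z, x) - 2 a f(x) + a^2 ||g||_x^2 <= D(z, x) - a f(x).
   Both terms of the minimum defining a are at least 1 / (4 M (D(z, x) + |z|_1)),
   M being the largest squared column norm, because |x|_1 <= 2 |z|_1 + 2 D(z, x).
   Hence f(x_k) is bounded by a telescoping term, which gives the rate for every
   solution z and f(x_k) -> 0.  The iterates are bounded; the limit x* of each
   coordinate along a common ultrafilter is a solution, D(x*, x_k) tends to 0
   along the ultrafilter and is monotone, hence D(x*, x_k) -> 0, and
   D(x*, x) >= sum_i (sqrt x*_i - sqrt x_i)^2 yields x_k -> x*. *)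
Require Import Defs.
From mathcomp Require Import all_boot all_algebra all_classical all_reals all_analysis.
From mathcomp Require Import order ring lra.
Set Implicit Arguments. Unset Strict Implicit. Unset Printing Implicit Defensive.
Import Order.TTheory GRing.Theory Num.Theory numFieldNormedType.Exports.
Local Open Scope classical_set_scope.
Local Open Scope ring_scope.

(** * Quadratic upper bound for the exponential *)

(* [1/1] Pade bound: the derivative of (2 + u) exp(-u) + u is
   1 - (1 + u) exp(-u) >= 0. *)
Lemma expR_le_pade11 (R : realType) (s : R) : 0 <= s ->
  (2 - s) * expR s <= 2 + s.
Proof.
move=> s0.
pose f (u : R) := (2 + u) * expR (- u) + u.
have df u : is_derive u (1 : R) f (1 - (1 + u) * expR (- u)).
  rewrite /f; apply: is_derive_eq; rewrite /GRing.scale /=; ring.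
have : f 0 <= f s.
  apply: (@ger0_derive1_le_cc R f 0 s) => //; try by rewrite in_itv /=; lra.
  - move=> u _; rewrite derive1E derive_val subr_ge0 expRN.
    by rewrite ler_pdivrMr ?expR_gt0 // mul1r expR_ge1Dx.
  - by apply: derivable_within_continuous => u _; case: (df u).
rewrite /f oppr0 expR0 !addr0 mulr1 -lerBlDr => h.
have := ler_wpM2r (expR_ge0 s) h.
by rewrite -mulrA -expRD addNr expR0 mulr1.
Qed.

(* The margin is only about 8e-4 in relative terms (e^1.79 = 5.98945, right-hand
   side 5.9941): the Pade bound at 1.79 / 32 is squared five times, with rational
   upper roundings. *)
Lemma expR_179_le (R : realType) :
  expR (179 / 100 : R) <= 1 + 179 / 100 + (179 / 100) ^+ 2.
Proof.
have sq (y a c : R) : 0 <= a -> a ^+ 2 <= c -> 0 <= y <= a -> 0 <= y ^+ 2 <= c.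
  move=> a0 ac /andP[y0 ya]; rewrite sqr_ge0; apply: le_trans ac.
  by rewrite lerXn2r ?nnegrE.
have e2 (y : R) : expR (y *+ 2) = expR y ^+ 2 by rewrite -mulr_natl expRM_natl.
have e : 179 / 100 = (179 / 100 / 32 : R) *+ 2 *+ 2 *+ 2 *+ 2 *+ 2 by field.
rewrite [in expR _]e !e2 {e e2}.
have : 0 <= expR (179 / 100 / 32 : R) <= 1121 / 1060.
  rewrite expR_ge0; have := @expR_le_pade11 R (179 / 100 / 32) ltac:(lra).
  move: (expR _) => y; lra.
move=> /(sq _ (1121 / 1060) (1039 / 929) ltac:(lra) ltac:(lra)).
move=> /(sq _ (1039 / 929) (374 / 299) ltac:(lra) ltac:(lra)).
move=> /(sq _ (374 / 299) (327 / 209) ltac:(lra) ltac:(lra)).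
move=> /(sq _ (327 / 209) (541 / 221) ltac:(lra) ltac:(lra)).
move=> /(sq _ (541 / 221) (803 / 134) ltac:(lra) ltac:(lra)).
by move=> /andP[_ h]; apply: le_trans h _; lra.
Qed.

(* (1 + u + u^2) exp(-u) has derivative u (1 - u) exp(-u), so on [-1.79, 1.79]
   its minimum is attained at 0 or at 1.79. *)
Lemma expR_le_quad (R : realType) (t : R) : `|t| <= 179 / 100 ->
  expR t <= 1 + t + t ^+ 2.
Proof.
rewrite ler_norml => /andP[tl tu].
pose f (u : R) := (1 + u + u ^+ 2) * expR (- u).
have df u : is_derive u (1 : R) f (u * (1 - u) * expR (- u)).
  rewrite /f; apply: is_derive_eq; rewrite /GRing.scale /=; ring.
have cf a c : {within `[a, c], continuous f}.
  by apply: derivable_within_continuous => u _; case: (df u).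
have f0 : f 0 = 1 by rewrite /f oppr0 expR0; ring.
suff h : 1 <= f t.
  have := ler_wpM2r (expR_ge0 t) h.
  by rewrite mul1r /f -mulrA -expRD addNr expR0 mulr1.
have dE u : derive1 f u = u * (1 - u) * expR (- u) by rewrite derive1E derive_val.
have [t0|t0] := lerP t 0.
  rewrite -f0; apply: (@ler0_derive1_le_cc R f t 0) => //;
    rewrite ?in_itv /= ?lexx ?t0 //.
  move=> u; rewrite in_itv /= => /andP[_ u0]; rewrite dE.
  by rewrite mulr_le0_ge0 ?expR_ge0 // mulr_le0_ge0 //; lra.
have [t1|t1] := lerP t 1.
  rewrite -f0; apply: (@ger0_derive1_le_cc R f 0 1) => //;
    rewrite ?in_itv /= ?ler01 ?lexx ?(ltW t0) //.
  move=> u; rewrite in_itv /= => /andP[u0 u1]; rewrite dE.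
  by rewrite !mulr_ge0 ?expR_ge0 ?subr_ge0 // ltW.
apply: (@le_trans _ _ (f (179 / 100))).
  by rewrite /f expRN ler_pdivlMr ?expR_gt0 // mul1r expR_179_le.
apply: (@ler0_derive1_le_cc R f 1 (179 / 100)) => //; rewrite ?in_itv /=; [|lra..].
move=> u; rewrite in_itv /= => /andP[u0 u1]; rewrite dE.
by rewrite mulr_le0_ge0 ?expR_ge0 // mulr_ge0_le0 //; lra.
Qed.

(** * Scalar entropy divergence, the summand of [breg_ent] *)

Definition ent (R : realType) (z x : R) : R :=
  (if z == 0 then 0 else z * ln (z / x)) - z + x.

(** With s = sqrt x / sqrt z, z ln (z / x) = - 2 z ln s >= 2 z - 2 sqrt (z x); adding x - z
    completes the square. For z = 0 both sides are x. *)
Lemma ent_ge_sqrt (R : realType) (z x : R) : 0 <= z -> 0 < x ->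
  (Num.sqrt z - Num.sqrt x) ^+ 2 <= ent z x.
Proof.
rewrite /ent le0r => /orP[/eqP -> |z0] x0.
  by rewrite eqxx sqrtr0 sub0r sqrrN (sqr_sqrtr (ltW x0)) subr0 add0r.
rewrite (gt_eqF z0) sqrrB (sqr_sqrtr (ltW z0)) (sqr_sqrtr (ltW x0)).
have [sz sx] : 0 < Num.sqrt z /\ 0 < Num.sqrt x by rewrite !sqrtr_gt0.
have : ln (Num.sqrt x / Num.sqrt z) <= Num.sqrt x / Num.sqrt z - 1.
  have := @le_ln1Dx R (Num.sqrt x / Num.sqrt z - 1).
  rewrite [1 + _]addrC subrK; apply; rewrite ltrBrDr addNr; exact: divr_gt0.
have -> : ln (z / x) = - (2 * ln (Num.sqrt x / Num.sqrt z)).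
  rewrite mulr_natl -lnXn ?divr_gt0 // expr_div_n (sqr_sqrtr (ltW z0)) (sqr_sqrtr (ltW x0)).
  by rewrite -lnV ?posrE ?divr_gt0 // invf_div.
move=> /(ler_wpM2l (ltW z0)).
rewrite mulrBr mulr1.
have -> : z * (Num.sqrt x / Num.sqrt z) = Num.sqrt z * Num.sqrt x.
  by rewrite -{1}(sqr_sqrtr (ltW z0)); field; rewrite gt_eqF.
lra.
Qed.

Lemma ent_ge0 (R : realType) (z x : R) : 0 <= z -> 0 < x -> 0 <= ent z x.
Proof. by move=> z0 x0; apply: le_trans (ent_ge_sqrt _ _) => //; apply: sqr_ge0. Qed.

(** By [ent_ge_sqrt] the gap is at least (2 sqrt z - sqrt x)^2. Summed over coordinates, this
    controls the mass of an iterate. *)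
Lemma le_ent (R : realType) (z x : R) : 0 <= z -> 0 < x ->
  x <= 2 * z + 2 * ent z x.
Proof.
move=> z0 x0; have := ent_ge_sqrt z0 x0.
rewrite -{3}(sqr_sqrtr z0) -{3}(sqr_sqrtr (ltW x0)).
have := sqr_ge0 (2 * Num.sqrt z - Num.sqrt x).
move: (ent _ _) (Num.sqrt z) (Num.sqrt x) => d p q; lra.
Qed.

(** Expand sum_i (S r_i - P a_i)^2 = S (S T - P^2) and divide by S; if S = 0, every a_i vanishes. *)
Lemma cauchy_schwarz_sum (R : realFieldType) (I : finType) (a r : I -> R) :
  (\sum_i a i * r i) ^+ 2 <= (\sum_i a i ^+ 2) * (\sum_i r i ^+ 2).
Proof.
set P := \sum_i a i * r i; set S := \sum_i a i ^+ 2; set T := \sum_i r i ^+ 2.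
have S0 : 0 <= S by apply: sumr_ge0 => i _; apply: sqr_ge0.
have : 0 <= \sum_i (S * r i - P * a i) ^+ 2.
  by apply: sumr_ge0 => i _; apply: sqr_ge0.
have -> : \sum_i (S * r i - P * a i) ^+ 2 = S * (S * T - P ^+ 2).
  transitivity (S ^+ 2 * T - 2 * S * P * P + P ^+ 2 * S); last by ring.
  rewrite [S ^+ 2 * T]mulr_sumr [2 * S * P * P]mulr_sumr [P ^+ 2 * S]mulr_sumr.
  rewrite -sumrB -big_split /=.
  by apply: eq_bigr => i _; ring.
move: S0; rewrite le0r => /orP[/eqP S0 _|S0]; last first.
  by rewrite pmulr_rge0 // subr_ge0.
have a0 i : a i = 0.
  apply/eqP; rewrite -sqrf_eq0; move/eqP: S0; rewrite psumr_eq0 => [|j _].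
    by move=> /allP/(_ i)/= -> //; rewrite mem_index_enum.
  exact: sqr_ge0.
by rewrite S0 mul0r /P big1 ?expr0n // => i _; rewrite a0 mul0r.
Qed.

(** * Least-squares estimates relative to a solution *)

Section LeastSquares.
Variables (R : realType) (m n : nat) (A : 'M[R]_(m, n)) (b : 'cV[R]_m).
Implicit Types (x z : 'cV[R]_n).

Let M := max_col_sqnorm A.

Lemma lsq_gradE x i :
  lsq_grad A b x i 0 = \sum_j A j i * (A *m x - b) j 0.
Proof. by rewrite mxE; apply: eq_bigr => j _; rewrite mxE. Qed.

Lemma lsq_obj_ge0 x : 0 <= lsq_obj A b x.
Proof. by rewrite mulr_ge0 ?invr_ge0 ?sumr_ge0 // => i _; apply: sqr_ge0. Qed.

Lemma residual_Splus x z : Splus A b z -> A *m x - b = A *m (x - z).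
Proof. by move=> [_ <-]; rewrite mulmxBr. Qed.

(** Moving A^T across the inner product gives <A x - b, A (x - z)>, the squared residual since A z =
    b. *)
Lemma lsq_grad_dot x z : Splus A b z ->
  \sum_i lsq_grad A b x i 0 * (x i 0 - z i 0) = 2 * lsq_obj A b x.
Proof.
move=> zS; rewrite /lsq_obj mulrA divff ?pnatr_eq0 // mul1r.
under eq_bigr do rewrite lsq_gradE mulr_suml.
rewrite exchange_big /=; apply: eq_bigr => j _.
rewrite expr2 {3}(residual_Splus x zS) [in RHS]mulrC [in RHS]mxE mulr_suml.
by apply: eq_bigr => i _; rewrite [(x - z) i 0]mxE [(- z) i 0]mxE; ring.
Qed.

Lemma max_col_sqnorm_ge j : \sum_(i < m) A i j ^+ 2 <= M.
Proof. exact: (le_bigmax 0 (fun j => \sum_(i < m) A i j ^+ 2) j). Qed.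

Lemma max_col_sqnorm_ge0 : 0 <= M.
Proof. exact: bigmax_ge_id. Qed.

Lemma lsq_grad_sqr_le x i : lsq_grad A b x i 0 ^+ 2 <= M * (2 * lsq_obj A b x).
Proof.
rewrite lsq_gradE; apply: le_trans (cauchy_schwarz_sum _ _) _.
rewrite [2 * _]mulrA divff ?pnatr_eq0 // mul1r.
apply: ler_wpM2r (max_col_sqnorm_ge i).
by apply: sumr_ge0 => j _; apply: sqr_ge0.
Qed.

(** The gradient is the Gram matrix A^T A applied to x - z, and 2 |a c| <= a^2 + c^2 bounds each
    Gram entry by M. *)
Lemma lsq_grad_norm_le x z i : Splus A b z ->
  `|lsq_grad A b x i 0| <= M * \sum_l `|x l 0 - z l 0|.
Proof.
move=> zS; rewrite lsq_gradE (residual_Splus x zS).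
have -> : \sum_j A j i * (A *m (x - z)) j 0 =
    \sum_l (\sum_j A j i * A j l) * (x l 0 - z l 0).
  under eq_bigr do rewrite mxE mulr_sumr.
  rewrite exchange_big; apply: eq_bigr => l _; rewrite mulr_suml.
  by apply: eq_bigr => j _; rewrite !mxE mulrA.
rewrite mulr_sumr; apply: le_trans (ler_norm_sum _ _ _) _.
apply: ler_sum => l _; rewrite normrM; apply: ler_wpM2r => //.
apply: le_trans (ler_norm_sum _ _ _) _.
apply: (@le_trans _ _ (\sum_j (2^-1 * A j i ^+ 2 + 2^-1 * A j l ^+ 2))).
  apply: ler_sum => j _; rewrite normrM.
  rewrite -[A j i ^+ 2]real_normK ?num_real // -[A j l ^+ 2]real_normK ?num_real //.
  by have := sqr_ge0 (`|A j i| - `|A j l|); lra.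
rewrite big_split -!mulr_sumr /=.
have := max_col_sqnorm_ge i; have := max_col_sqnorm_ge l; lra.
Qed.

Lemma norm1_Splus z : Splus A b z -> norm1 z = \sum_i z i 0.
Proof. by move=> [z0 _]; apply: eq_bigr => i _; rewrite ger0_norm. Qed.

Lemma sum_le_breg_ent x z : (forall i, 0 <= z i 0) -> (forall i, 0 < x i 0) ->
  \sum_i x i 0 <= 2 * \sum_i z i 0 + 2 * breg_ent z x.
Proof.
move=> z0 x0; rewrite /breg_ent !mulr_sumr -big_split /=.
by apply: ler_sum => i _; apply: le_ent.
Qed.

Lemma breg_ent_ge0 x z : (forall i, 0 <= z i 0) -> (forall i, 0 < x i 0) ->
  0 <= breg_ent z x.
Proof. by move=> z0 x0; apply: sumr_ge0 => i _; apply: ent_ge0. Qed.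

(** By [lsq_grad_dot]; hence the iteration freezes only where A x = b. *)
Lemma lsq_grad_eq0 x z : Splus A b z -> lsq_grad A b x = 0 -> lsq_obj A b x = 0.
Proof.
move=> zS g0; apply/eqP; have := lsq_grad_dot x zS.
rewrite g0 big1 => [/eqP|i _]; last by rewrite mxE mul0r.
by rewrite eq_sym mulf_eq0 pnatr_eq0.
Qed.

Lemma lsq_obj_eq0 x : lsq_obj A b x = 0 -> A *m x = b.
Proof.
move/eqP; rewrite mulf_eq0 invr_eq0 pnatr_eq0 /= psumr_eq0 => [/allP h|i _].
  apply/eqP; rewrite -subr_eq0; apply/eqP/matrixP => i j; rewrite ord1 [RHS]mxE.
  by apply/eqP; rewrite -sqrf_eq0; have /= := h i (mem_index_enum i).
exact: sqr_ge0.
Qed.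

Lemma emd_update_gt0 x : (forall i, 0 < x i 0) ->
  forall i, 0 < emd_update A b x i 0.
Proof.
by move=> x0 i; rewrite /emd_update; case: ifP => // _; rewrite mxE mulr_gt0 ?expR_gt0.
Qed.

Lemma emd_seq_gt0 x k : (forall i, 0 < x i 0) ->
  forall i, 0 < emd_seq A b x k i 0.
Proof. by move=> x0; elim: k => //= k IH i; apply: emd_update_gt0. Qed.

End LeastSquares.

(** The logarithm makes the z-part linear in t and leaves one exponential, to which [expR_le_quad]
    applies. *)
Lemma ent_mul_expR (R : realType) (z x t : R) : 0 <= z -> 0 < x ->
  ent z (x * expR (- t)) = ent z x + t * z + x * (expR (- t) - 1).
Proof.
rewrite /ent le0r => /orP[/eqP -> x0|z0 x0]; first by rewrite eqxx; ring.
rewrite (gt_eqF z0) !ln_div ?posrE ?mulr_gt0 ?expR_gt0 //.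
by rewrite lnM ?posrE ?expR_gt0 // expRK; ring.
Qed.

(** * A single mirror step at a nonzero gradient *)

Section Step.
Variables (R : realType) (m n : nat) (A : 'M[R]_(m, n)) (b : 'cV[R]_m).
Variables (x z : 'cV[R]_n).
Hypotheses (zS : Splus A b z) (x0 : forall i, 0 < x i 0).
Hypothesis g0 : lsq_grad A b x != 0.

Local Notation M := (max_col_sqnorm A).
Local Notation f := (lsq_obj A b x).
Local Notation g := (lsq_grad A b x).
Local Notation W := (wnorm2 x g).
Local Notation D := (breg_ent z x).
Local Notation alpha := (emd_step A b x).

(** A nonzero gradient makes f, W and the infinity norm positive, so neither quotient in the
    stepsize divides by zero. *)
Let gi0 : exists i, g i 0 != 0.
Proof.
apply/existsP; rewrite -negb_forall; apply: contra g0 => /forallP h.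
by apply/eqP/matrixP => i j; rewrite ord1 [RHS]mxE; apply/eqP.
Qed.

Let f_gt0 : 0 < f.
Proof.
rewrite lt0r lsq_obj_ge0 andbT; apply: contra g0 => /eqP /lsq_obj_eq0 e.
by rewrite /lsq_grad e subrr mulmx0.
Qed.

Let W_gt0 : 0 < W.
Proof.
have [i gi] := gi0; rewrite /wnorm2 (bigD1 i) //= ltr_pwDl //.
  by rewrite mulr_gt0 // lt0r sqrf_eq0 gi sqr_ge0.
by apply: sumr_ge0 => j _; rewrite mulr_ge0 ?sqr_ge0 // ltW.
Qed.

Let infnorm_ge i : `|g i 0| <= infnorm g.
Proof. exact: (le_bigmax 0 (fun i => `|g i 0|) i). Qed.

Let infnorm_gt0 : 0 < infnorm g.
Proof. by have [i gi] := gi0; apply: lt_le_trans (infnorm_ge i); rewrite normr_gt0. Qed.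

Lemma emd_step_ge0 : 0 <= alpha.
Proof.
by rewrite /emd_step le_min !divr_ge0 ?ler0n ?(ltW W_gt0) ?(ltW f_gt0) ?(ltW infnorm_gt0).
Qed.

(** The second term of the minimum keeps every exponent in [-1.79, 1.79]; the first gives alpha W <=
    f, so the quadratic remainder uses up at most half of the gain 2 alpha f. *)
Lemma breg_ent_emd_update :
  breg_ent z (emd_update A b x) <= D - alpha * f.
Proof.
have [z0 _] := zS.
have aW : alpha * W <= f by rewrite -ler_pdivlMr // ge_min lexx.
have ag i : `|- (alpha * g i 0)| <= 179 / 100.
  rewrite normrN normrM ger0_norm ?emd_step_ge0 //.
  apply: (@le_trans _ _ (alpha * infnorm g)); first exact: (ler_wpM2l emd_step_ge0).
  by rewrite -ler_pdivlMr // ge_min lexx orbT.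
apply: (@le_trans _ _ (D - alpha * (2 * f) + alpha * (alpha * W))); last first.
  by have := ler_wpM2l emd_step_ge0 aW; lra.
(* Writing 2 f as <g, x - z> makes the claim a sum of coordinatewise inequalities. *)
rewrite -(lsq_grad_dot x zS) /wnorm2 /breg_ent !mulr_sumr -sumrB -big_split /=.
apply: ler_sum => i _; rewrite /emd_update (negbTE g0) mxE.
rewrite -!/(ent _ _) ent_mul_expR //.
have := ler_wpM2l (ltW (x0 i)) (expR_le_quad (ag i)).
move: (expR _) (ent _ _) => e d; lra.
Qed.

(* The second term of the minimum needs infnorm g <= 1.79 C; since
   |x - z|_1 <= 2 D + 3 |z|_1, this holds with room to spare (1.79 * 4 >= 3). *)
Lemma lsq_obj_le_step : f <= 4 * M * (D + norm1 z) * (alpha * f).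
Proof.
have [z0 _] := zS.
have M0 := max_col_sqnorm_ge0 A.
have D0 : 0 <= D by apply: breg_ent_ge0.
have sz0 : 0 <= \sum_i z i 0 by apply: sumr_ge0.
have xz := sum_le_breg_ent z0 x0.
rewrite (norm1_Splus zS).
set C := 4 * M * _.
have C0 : 0 <= C by rewrite !mulr_ge0 // addr_ge0.
(* Here W <= |x|_1 * 2 M f and |x|_1 <= 2 |z|_1 + 2 D, whence the factor 4 in C. *)
have hW : W <= C * f.
  apply: (@le_trans _ _ ((\sum_i x i 0) * (M * (2 * f)))).
    rewrite /wnorm2 mulr_suml; apply: ler_sum => i _.
    by apply: ler_wpM2l; [exact: ltW|exact: lsq_grad_sqr_le].
  rewrite /C; have Mf : 0 <= M * (2 * f) by rewrite mulr_ge0 // mulr_ge0 // ltW.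
  by have := ler_wpM2r Mf xz; lra.
have hG : infnorm g <= 179 / 100 * C.
  apply: bigmax_le => [|i _]; first by rewrite mulr_ge0.
  apply: le_trans (lsq_grad_norm_le x i zS) _.
  apply: (@le_trans _ _ (M * (2 * D + 3 * \sum_i z i 0))).
    apply: ler_wpM2l => //.
    apply: (@le_trans _ _ (\sum_i x i 0 + \sum_i z i 0)); last by lra.
    rewrite -big_split; apply: ler_sum => l _ /=.
    by apply: le_trans (ler_normB _ _) _; rewrite (gtr0_norm (x0 l)) (ger0_norm (z0 l)).
  by rewrite /C; have := mulr_ge0 M0 D0; have := mulr_ge0 M0 sz0; lra.
(* Cancelling f > 0 leaves 1 <= C * alpha, checked on each term of the minimum. *)
rewrite mulrA ler_pMl // /emd_step minr_pMr // le_min.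
rewrite [_ * (f / _)]mulrA [_ * (_ / infnorm _)]mulrA !ler_pdivlMr // !mul1r hW; lra.
Qed.

End Step.

(** Joins the two step estimates in a form that telescopes; at a zero gradient f and the difference
    are both 0. *)
Lemma lsq_obj_le_breg_diff (R : realType) (m n : nat) (A : 'M[R]_(m, n))
    (b : 'cV[R]_m) (x z : 'cV[R]_n) :
  Splus A b z -> (forall i, 0 < x i 0) ->
  breg_ent z (emd_update A b x) <= breg_ent z x /\
  lsq_obj A b x <= 4 * max_col_sqnorm A * (breg_ent z x + norm1 z) *
                   (breg_ent z x - breg_ent z (emd_update A b x)).
Proof.
move=> zS x0; have [g0|g0] := eqVneq (lsq_grad A b x) 0.
  by rewrite /emd_update g0 eqxx subrr mulr0 (lsq_grad_eq0 zS g0).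
have C0 : 0 <= 4 * max_col_sqnorm A * (breg_ent z x + norm1 z).
  have [z0 _] := zS.
  rewrite !mulr_ge0 ?max_col_sqnorm_ge0 // addr_ge0 ?breg_ent_ge0 //.
  by apply: sumr_ge0.
have step := breg_ent_emd_update zS x0 g0.
split.
  apply: le_trans step _; rewrite gerBl.
  by rewrite mulr_ge0 ?lsq_obj_ge0 ?emd_step_ge0.
apply: le_trans (lsq_obj_le_step zS x0 g0) _.
by apply: ler_wpM2l => //; lra.
Qed.

(** * Limits along arbitrary filters *)

Lemma fmap_ultra (T U : Type) (h : T -> U) (F : set_system T) :
  UltraFilter F -> UltraFilter (h @ F).
Proof.
move=> FU; split; first exact: fmap_proper_filter.
move=> G GP FG; apply/seteqP; split=> // B GB.
have [//|FB] := in_ultra_setVsetC (h @^-1` B) FU.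
have /FG GC : (h @ F) (~` B) by [].
by have [y []] := filter_ex (filterI GB GC).
Qed.

Lemma cvg_sum (R : realType) (I T : Type) (F : set_system T) (FF : Filter F)
    (r : seq I) (u : I -> T -> R) (l : I -> R) :
  (forall i, u i t @[t --> F] --> l i) ->
  \sum_(i <- r) u i t @[t --> F] --> \sum_(i <- r) l i.
Proof. by move=> ul; apply: cvg_big => //; exact: add_continuous. Qed.

Lemma cvg_col (R : realType) (n : nat) (T : Type) (F : set_system T)
    (FF : Filter F) (u : T -> 'cV[R]_n) (l : 'cV[R]_n) :
  (forall i, u t i 0 @[t --> F] --> l i 0) -> u t @[t --> F] --> l.
Proof.
move=> ul B [P Pl PB].
have : \forall t \near F, forall i, P i 0 (u t i 0).
  by apply: filter_forall => i; apply: ul; apply: Pl.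
by apply: filterS => t h; apply: PB => i j; rewrite ord1.
Qed.

Lemma cvg_lsq_obj (R : realType) (m n : nat) (A : 'M[R]_(m, n)) (b : 'cV[R]_m)
    (T : Type) (F : set_system T) (FF : Filter F) (u : T -> 'cV[R]_n) (l : 'cV[R]_n) :
  (forall i, u t i 0 @[t --> F] --> l i 0) ->
  lsq_obj A b (u t) @[t --> F] --> lsq_obj A b l.
Proof.
move=> ul; apply: cvgMr; apply: cvg_sum => i.
have coordE x : (A *m x - b) i 0 = \sum_j A i j * x j 0 - b i 0 by rewrite !mxE.
rewrite expr2; under eq_cvg do rewrite expr2.
suff h : (A *m u t - b) i 0 @[t --> F] --> (A *m l - b) i 0 by apply: cvgM.
rewrite coordE; under eq_cvg do rewrite coordE.
apply: cvgB; last exact: cvg_cst.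
by apply: cvg_sum => j; apply: cvgMr.
Qed.

(** Where l_i = 0 the summand is u_i itself, which tends to 0; elsewhere [ln] is continuous at l_i /
    l_i = 1. *)
Lemma cvg_breg_ent_self (R : realType) (n : nat)
    (T : Type) (F : set_system T) (FF : Filter F) (u : T -> 'cV[R]_n) (l : 'cV[R]_n) :
  (forall i, 0 <= l i 0) ->
  (forall i, u t i 0 @[t --> F] --> l i 0) ->
  breg_ent l (u t) @[t --> F] --> 0.
Proof.
move=> l0 ul; have -> : 0 = \sum_(i < n) 0 :> R by rewrite big1.
apply: cvg_sum => i.
have [li0|li0] := eqVneq (l i 0) 0.
  under eq_cvg do rewrite li0 subr0 add0r.
  by have := ul i; rewrite li0.
have lp : 0 < l i 0 by rewrite lt0r li0 l0.
have -> : 0 = l i 0 * ln (l i 0 / l i 0) - l i 0 + l i 0.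
  by rewrite divff // ln1 mulr0 sub0r addNr.
apply: cvgD => //; apply: cvgB; last exact: cvg_cst.
apply: cvgMr; apply: continuous_cvg; first by apply: continuous_ln; rewrite divr_gt0.
by apply: cvgMr; apply: cvgV.
Qed.

Lemma cvg_of_breg_ent (R : realType) (n : nat)
    (T : Type) (F : set_system T) (FF : Filter F) (u : T -> 'cV[R]_n) (l : 'cV[R]_n) :
  (forall i, 0 <= l i 0) -> (forall t i, 0 < u t i 0) ->
  breg_ent l (u t) @[t --> F] --> 0 ->
  u t @[t --> F] --> l.
Proof.
move=> l0 u0 D0; apply: cvg_col => i.
have sq0 : (Num.sqrt (l i 0) - Num.sqrt (u t i 0)) ^+ 2 @[t --> F] --> 0.
  (* All summands of the divergence being nonnegative, the i-th one is at most the whole. *)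
  apply: (squeeze_cvgr _ (cvg_cst 0) D0); near=> t.
  rewrite sqr_ge0 /=; apply: le_trans (ent_ge_sqrt (l0 i) (u0 t i)) _.
  rewrite /breg_ent (bigD1 i) //= lerDl; apply: sumr_ge0 => j _.
  exact: ent_ge0.
have d0 : Num.sqrt (l i 0) - Num.sqrt (u t i 0) @[t --> F] --> 0.
  apply/norm_cvg0P.
  have -> : 0 = Num.sqrt 0 :> R by rewrite sqrtr0.
  under eq_cvg do rewrite -sqrtr_sqr.
  by apply: continuous_cvg => //; apply: sqrt_continuous.
have s : Num.sqrt (u t i 0) @[t --> F] --> Num.sqrt (l i 0).
  rewrite -[X in _ --> X]subr0.
  under eq_cvg do rewrite -[Num.sqrt _](subKr (Num.sqrt (l i 0))).
  by apply: cvgB => //; apply: cvg_cst.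
rewrite -[X in _ --> X]sqr_sqrtr // expr2.
under eq_cvg do rewrite -[u _ i 0]sqr_sqrtr ?(ltW (u0 _ i)) // expr2.
exact: cvgM.
Unshelve. all: by end_near. Qed.

(** * Rate and convergence of the iterates *)

Section Sequence.
Variables (R : realType) (m n : nat) (A : 'M[R]_(m, n)) (b : 'cV[R]_m).
Variables (x0 : 'cV[R]_n).
Hypothesis x0_gt0 : forall i, 0 < x0 i 0.

Local Notation x := (emd_seq A b x0).
Local Notation C z := (4 * max_col_sqnorm A * (breg_ent z x0 + norm1 z)).

Lemma breg_ent_emd_seq_nonincreasing z : Splus A b z ->
  nonincreasing_seq (fun k => breg_ent z (x k)).
Proof.
move=> zS; apply/nonincreasing_seqP => k /=.
by have [] := lsq_obj_le_breg_diff zS (emd_seq_gt0 A b k x0_gt0).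
Qed.

(** Monotonicity replaces D(z, x_k) by D(z, x_0) in the constant, which becomes independent of k. *)
Lemma lsq_obj_emd_seq_le z k : Splus A b z ->
  lsq_obj A b (x k) <= C z * (breg_ent z (x k) - breg_ent z (x k.+1)).
Proof.
move=> zS; have xk0 := emd_seq_gt0 A b k x0_gt0.
have [mono] := lsq_obj_le_breg_diff zS xk0.
move=> /le_trans; apply; apply: ler_wpM2r; first by rewrite subr_ge0.
apply: ler_wpM2l; first by rewrite mulr_ge0 ?max_col_sqnorm_ge0.
by rewrite lerD2r; apply: (breg_ent_emd_seq_nonincreasing zS (leq0n k)).
Qed.

(** k + 1 times the minimum is at most the sum of the f(x_i), which telescopes. The default f(x_0)
    is also the term i = 0, so it does not alter the minimum. *)
Lemma min_lsq_obj_emd_seq_le z k : Splus A b z ->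
  \big[Num.min/lsq_obj A b x0]_(i < k.+1) lsq_obj A b (x i) <=
  C z * breg_ent z x0 / k.+1%:R.
Proof.
move=> zS; have [z0 _] := zS.
have C0 : 0 <= C z.
  rewrite !mulr_ge0 ?max_col_sqnorm_ge0 // addr_ge0 ?breg_ent_ge0 //.
  by apply: sumr_ge0.
rewrite ler_pdivlMr ?ltr0n // mulr_natr; set mn := \big[_/_]_(i < _) _.
have -> : mn *+ k.+1 = \sum_(i < k.+1) mn by rewrite sumr_const card_ord.
apply: (@le_trans _ _ (\sum_(i < k.+1) C z * (breg_ent z (x i) - breg_ent z (x i.+1)))).
  apply: ler_sum => i _; apply: le_trans _ (lsq_obj_emd_seq_le i zS).
  exact: (bigmin_le _ i (fun i : 'I_k.+1 => lsq_obj A b (x i))).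
rewrite -mulr_sumr; apply: ler_wpM2l => //.
under eq_bigr do rewrite -opprB.
rewrite sumrN -(big_mkord xpredT (fun i => breg_ent z (x i.+1) - breg_ent z (x i))).
rewrite telescope_sumr // opprB gerBl breg_ent_ge0 //.
exact: emd_seq_gt0.
Qed.

Lemma breg_ent_emd_seq_is_cvg z : Splus A b z -> cvgn (fun k => breg_ent z (x k)).
Proof.
move=> zS; apply: nonincreasing_is_cvgn; first exact: breg_ent_emd_seq_nonincreasing.
exists 0 => _ [k _ <-]; apply: breg_ent_ge0; first by case: zS.
exact: emd_seq_gt0.
Qed.

Lemma cvg_lsq_obj_emd_seq z : Splus A b z -> lsq_obj A b (x k) @[k --> \oo] --> 0.
Proof.
move=> zS; have Dl := breg_ent_emd_seq_is_cvg zS.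
pose B k := C z * (breg_ent z (x k) - breg_ent z (x k.+1)).
have B0 : B k @[k --> \oo] --> 0.
  rewrite -(mulr0 (C z)) -(subrr (limn (fun k => breg_ent z (x k)))).
  apply: cvgMr; apply: cvgB => //.
  by rewrite (cvg_shiftS (fun k => breg_ent z (x k))).
apply: (squeeze_cvgr _ (cvg_cst 0) B0).
by near=> k; rewrite lsq_obj_ge0 lsq_obj_emd_seq_le.
Unshelve. all: by end_near. Qed.

(** A single ultrafilter refining [\oo] serves all coordinates at once, in place of successive
    subsequences; each coordinate stays in the compact segment [0, B]. *)
Lemma emd_seq_ultra_limit z : Splus A b z ->
  exists U : set_system nat, exists2 l : 'cV[R]_n, ProperFilter U /\ \oo `<=` U &
    (forall i, 0 <= l i 0) /\ forall i, x k i 0 @[k --> U] --> l i 0.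
Proof.
move=> zS; have [z0 _] := zS.
have [U [UU ooU]] := ultraFilterLemma eventually_filter.
pose B := 2 * \sum_i z i 0 + 2 * breg_ent z x0.
have xB k i : 0 <= x k i 0 <= B.
  have xk0 := emd_seq_gt0 A b k x0_gt0.
  rewrite ltW //=; apply: (@le_trans _ _ (\sum_i x k i 0)).
    by rewrite (bigD1 i) //= lerDl sumr_ge0 // => j _; apply: ltW.
  apply: le_trans (sum_le_breg_ent z0 xk0) _; rewrite lerD2l.
  by apply: ler_wpM2l => //; apply: (breg_ent_emd_seq_nonincreasing zS (leq0n k)).
have /choice[l hl] : forall i, exists y : R, 0 <= y /\ x k i 0 @[k --> U] --> y.
  move=> i; have := @segment_compact R 0 B; rewrite compact_ultra.
  move=> /(_ (x k i 0 @[k --> U]) (fmap_ultra _ UU)) [].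
    by apply: (@filterE _ U) => k /=; rewrite in_itv /=; exact: xB.
  by move=> y [/=]; rewrite in_itv /= => /andP[y0 _] cy; exists y.
exists U, (\col_i l i); first by split => //; exact: ultra_proper.
by split=> i; rewrite mxE; have [] := hl i.
Qed.

End Sequence.

Theorem theorem3p4 (R : realType) (m n : nat) (A : 'M[R]_(m, n)) (b : 'cV[R]_m)
    (x0 : 'cV[R]_n) :
  (exists z, Splus A b z) ->
  (forall i, 0 < x0 i 0) ->
  exists xstar : 'cV[R]_n,
    Splus A b xstar /\
    (emd_seq A b x0 k @[k --> \oo] --> xstar) /\
    forall k : nat,
      \big[Num.min/lsq_obj A b x0]_(i < k.+1) lsq_obj A b (emd_seq A b x0 i)
      <= 4%:R * breg_ent xstar x0 * (breg_ent xstar x0 + norm1 xstar)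
           * max_col_sqnorm A / k.+1%:R.
Proof.
move=> [z zS] x0_gt0.
have [U [l [UF ooU] [l0 xl]]] := emd_seq_ultra_limit x0_gt0 zS.
(* f(x_k) tends to f(l) along U by continuity, and to 0 because U refines [\oo]. *)
have fl0 : lsq_obj A b l = 0.
  apply: (@cvg_unique _ _ (lsq_obj A b (emd_seq A b x0 k) @[k --> U])).
  - exact: norm_hausdorff.
  - exact: cvg_lsq_obj.
  - by move=> V /(cvg_lsq_obj_emd_seq x0_gt0 zS) /ooU.
have lS : Splus A b l by split => //; apply: lsq_obj_eq0.
exists l; split=> //; split; last first.
  move=> k; have := min_lsq_obj_emd_seq_le x0_gt0 k lS.
  by congr (_ <= _ / _); ring.
apply: cvg_of_breg_ent => //; first by move=> k; apply: emd_seq_gt0.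
have Dcvg := breg_ent_emd_seq_is_cvg x0_gt0 lS.
(* D(l, x_k) already converges along [\oo], so its limit can be identified along U, where it is
   0. *)
rewrite (_ : 0 = limn (fun k => breg_ent l (emd_seq A b x0 k))) //.
apply: (@cvg_unique _ _ (breg_ent l (emd_seq A b x0 k) @[k --> U])).
- exact: norm_hausdorff.
- exact: cvg_breg_ent_self.
- by move=> V /Dcvg /ooU.
Qed.
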